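(* Let $(a_n)_{n\ge 1}$ be the Ulam sequence. Then there exists $N \in \mathbb{N}$ such that for all $n \geq N$, $$ a_n \leq 1.454^n.$$
   Context: The Ulam sequence $(a_n)_{n \geq 1}$ is the strictly increasing sequence of positive integers defined by $a_1 = 1$, $a_2 = 2$ and, for $n \geq 2$, $a_{n+1}$ is the smallest integer greater than $a_n$ that can be written in exactly one way as a sum $a_i + a_j$ with $1 \leq i < j \leq n$ (i.e. as a sum of two distinct earlier terms, uniquely). It begins $1,2,3,4,6,8,11,13,\dots$. The sequence is known to be infinite (well-defined for all $n$). *)

(* Defs.v *)
From Stdlib Require Import Arith Lia Wf_nat Classical ClassicalEpsilon.

(* Ways of writing [m] as a sum are counted by index pairs [i < j]; since the
   sequence is strictly increasing, these are pairs of distinct terms. *)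
Definition unique_sum (a : nat -> nat) (n m : nat) : Prop :=
  exists! p : nat * nat,
    let (i, j) := p in 1 <= i /\ i < j /\ j <= n /\ a i + a j = m.

(* Indexing starts at 1: the value [a 0] is unconstrained. *)
Definition is_ulam (a : nat -> nat) : Prop :=
  a 1 = 1 /\ a 2 = 2 /\
  forall n : nat, 2 <= n ->
    (a n < a (n + 1) /\ unique_sum a n (a (n + 1))) /\
    (forall m : nat, a n < m -> unique_sum a n m -> a (n + 1) <= m).

Lemma unique_sum_ext (a b : nat -> nat) (n m : nat) :
  (forall k, 1 <= k <= n -> a k = b k) -> unique_sum a n m -> unique_sum b n m.
Proof.
  intros E [[i j] [(H1 & H2 & H3 & H4) U]].
  exists (i, j); split.
  - rewrite <- !E by lia. auto.
  - intros [k l] (K1 & K2 & K3 & K4). apply U.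
    rewrite !E by lia. auto.
Qed.

Definition next_ulam (a : nat -> nat) (n v : nat) : Prop :=
  (a n < v /\ unique_sum a n v) /\
  (forall m, a n < m -> unique_sum a n m -> v <= m).

Lemma next_ulam_exists (a : nat -> nat) (n : nat) :
  2 <= n -> 0 < a 1 -> (forall i j, 1 <= i -> i < j -> j <= n -> a i < a j) ->
  exists v, next_ulam a n v.
Proof.
  intros Hn H1 Hinc.
  destruct (dec_inh_nat_subset_has_unique_least_element
              (fun v => a n < v /\ unique_sum a n v)) as [v [[Pv Lv] _]].
  - intros v; apply classic.
  - exists (a (n - 1) + a n). split.
    + enough (0 < a (n - 1)) by lia.
      destruct (Nat.eq_dec n 2) as [-> | N]; [exact H1|].
      specialize (Hinc 1 (n - 1)). lia.
    + exists (n - 1, n). split; [lia|].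
      intros [i j] (K1 & K2 & K3 & K4).
      assert (j = n).
      { destruct (Nat.eq_dec j n); [assumption|].
        assert (a i < a (n - 1)) by (apply Hinc; lia).
        assert (a j < a n) by (apply Hinc; lia). lia. }
      subst j.
      destruct (Nat.eq_dec i (n - 1)); [congruence|].
      assert (a i < a (n - 1)) by (apply Hinc; lia). lia.
  - exists v. split; [exact Pv|]. intros m M1 M2. apply Lv. auto.
Qed.

Fixpoint ulam_prefix (k : nat) : nat -> nat :=
  match k with
  | 0 => fun i => i
  | S k' => fun i =>
      if i =? k' + 3
      then epsilon (inhabits 0) (next_ulam (ulam_prefix k') (k' + 2))
      else ulam_prefix k' i
  end.

Lemma ulam_prefix_stable (k d i : nat) :
  i <= k + 2 -> ulam_prefix (k + d) i = ulam_prefix k i.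
Proof.
  intros Hi. induction d as [|d IH]; [now rewrite Nat.add_0_r|].
  rewrite Nat.add_succ_r. simpl.
  destruct (Nat.eqb_spec i (k + d + 3)); [lia | exact IH].
Qed.

Lemma ulam_prefix_next (k : nat) :
  (forall i j, 1 <= i -> i < j -> j <= k + 2 ->
     ulam_prefix k i < ulam_prefix k j) /\
  next_ulam (ulam_prefix k) (k + 2) (ulam_prefix (S k) (k + 3)).
Proof.
  assert (E : forall l,
    (forall i j, 1 <= i -> i < j -> j <= l + 2 ->
       ulam_prefix l i < ulam_prefix l j) ->
    next_ulam (ulam_prefix l) (l + 2) (ulam_prefix (S l) (l + 3))).
  { intros l H. simpl. rewrite Nat.eqb_refl. apply epsilon_spec.
    apply next_ulam_exists; [lia| |exact H].
    change l with (0 + l). rewrite ulam_prefix_stable by lia. simpl. lia. }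
  induction k as [|k [IH1 IH2]].
  - split; [simpl; lia|]. apply E. simpl; lia.
  - assert (I : forall i j, 1 <= i -> i < j -> j <= S k + 2 ->
              ulam_prefix (S k) i < ulam_prefix (S k) j).
    { intros i j Hi Hij Hj.
      assert (S1 : forall x, x <= k + 2 -> ulam_prefix (S k) x = ulam_prefix k x).
      { intros x Hx. rewrite <- (Nat.add_1_r k). now apply ulam_prefix_stable. }
      destruct (Nat.eq_dec j (k + 3)) as [-> | N].
      - destruct IH2 as [[Hlt _] _]. rewrite (S1 i) by lia.
        destruct (Nat.eq_dec i (k + 2)) as [-> | N']; [exact Hlt|].
        assert (ulam_prefix k i < ulam_prefix k (k + 2)) by (apply IH1; lia).
        lia.
      - rewrite !S1 by lia. apply IH1; lia. }
    split; [exact I | now apply E].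
Qed.

Lemma ulam_exists : exists a : nat -> nat, is_ulam a.
Proof.
  exists (fun n => ulam_prefix n n).
  split; [reflexivity|]. split; [reflexivity|].
  intros n Hn.
  assert (St : forall i, i <= n -> ulam_prefix (n - 2) i = ulam_prefix i i).
  { intros i Hi. destruct (le_ge_dec i (n - 2)) as [L | L].
    - replace (n - 2) with (i + (n - 2 - i)) by lia.
      apply ulam_prefix_stable; lia.
    - replace i with (n - 2 + (i - (n - 2))) at 2 by lia.
      symmetry; apply ulam_prefix_stable; lia. }
  destruct (ulam_prefix_next (n - 2)) as [_ [[H1 H2] H3]].
  assert (V : ulam_prefix (S (n - 2)) (n - 2 + 3) = ulam_prefix (n + 1) (n + 1)).
  { replace (n - 2 + 3) with (n + 1) by lia.
    replace (ulam_prefix (n + 1)) with (ulam_prefix (S (n - 2) + 2))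
      by (f_equal; lia).
    symmetry; apply ulam_prefix_stable; lia. }
  rewrite V in *. replace (n - 2 + 2) with n in * by lia.
  rewrite (St n) in * by lia.
  split; [split|].
  - exact H1.
  - apply (unique_sum_ext (ulam_prefix (n - 2))); [|exact H2].
    intros k Hk; apply St; lia.
  - intros m M1 M2. apply H3; [exact M1|].
    apply (unique_sum_ext (fun n => ulam_prefix n n)); [|exact M2].
    intros k Hk; symmetry; apply St; lia.
Qed.

Lemma ulam_unique (a b : nat -> nat) : is_ulam a -> is_ulam b ->
  forall n, 1 <= n -> a n = b n.
Proof.
  intros (A1 & A2 & A) (B1 & B2 & B) n.
  induction n as [n IH] using lt_wf_ind. intros Hn.
  destruct (Nat.eq_dec n 1) as [-> | N1]; [congruence|].
  destruct (Nat.eq_dec n 2) as [-> | N2]; [congruence|].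
  destruct (A (n - 1)) as [[Al Au] Am]; [lia|].
  destruct (B (n - 1)) as [[Bl Bu] Bm]; [lia|].
  replace (n - 1 + 1) with n in * by lia.
  assert (E : a (n - 1) = b (n - 1)) by (apply IH; lia).
  apply Nat.le_antisymm.
  - apply Am; [lia|]. apply (unique_sum_ext b); [|exact Bu].
    intros k Hk; symmetry; apply IH; lia.
  - apply Bm; [lia|]. apply (unique_sum_ext a); [|exact Au].
    intros k Hk; apply IH; lia.
Qed.

(* Main.v *)
Require Import Defs.
From Stdlib Require Import Reals.
From Stdlib Require Import Arith Lia Lra.

(** The idea is to bound each new term by the largest sums of two earlier
    terms, which have few competing representations.

    The sum [a n + a (n - 2)] is always represented uniquely: the only larger
    sum of two terms up to [a n] is [a n + a (n - 1)], and every other sum is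
    smaller.  Hence [a (n + 1) <= a n + a (n - 2)] ([ulam_step]).  The next
    sum, [a n + a (n - 3)], can only be represented a second time as
    [a (n - 1) + a (n - 2)].  If this does not happen, then
    [a (n + 1) <= a n + a (n - 3)].  If it does, then
    [a n = a (n - 1) + (a (n - 2) - a (n - 3))], where the last difference is
    at most [a (n - 5)] by [ulam_step], so that
    [a (n + 1) <= a n + a (n - 2) <= a (n - 1) + a (n - 2) + a (n - 5)].

    This dichotomy ([ulam_recurrence]) gives exponential growth at any rate
    [x > 1] with [x ^ 4 >= x ^ 3 + 1] and [x ^ 6 >= x ^ 4 + x ^ 3 + 1].  Both
    hold for [x = 1.41], so [a n <= C * 1.41 ^ n] for some constant [C], and
    this is eventually below [1.454 ^ n]. *)

Lemma ulam_lt (a : nat -> nat) (ha : is_ulam a) (i j : nat) :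
  1 <= i -> i < j -> a i < a j.
Proof.
  destruct ha as (A1 & A2 & A). intros Hi Hij.
  assert (S1 : forall k, 1 <= k -> a k < a (S k)).
  { intros k Hk. destruct (Nat.eq_dec k 1) as [-> | N]; [lia|].
    rewrite <- (Nat.add_1_r k). apply A; lia. }
  induction Hij as [|j Hij IH]; [now apply S1|].
  specialize (S1 j). lia.
Qed.

Lemma ulam_le (a : nat -> nat) (ha : is_ulam a) (i j : nat) :
  1 <= i -> i <= j -> a i <= a j.
Proof.
  intros Hi Hij. destruct (Nat.eq_dec i j) as [-> | N]; [lia|].
  apply Nat.lt_le_incl, ulam_lt; [exact ha | lia | lia].
Qed.

Lemma ulam_pos (a : nat -> nat) (ha : is_ulam a) (i : nat) :
  1 <= i -> 0 < a i.
Proof.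
  intros Hi. pose proof (ulam_le a ha 1 i). destruct ha as [A1 _]. lia.
Qed.

(** For a representation [a i + a j = a n + a k], strict monotonicity forces
    either [i = k] and [j = n], or [k < i] and [j < n]. *)
Lemma ulam_sum_between (a : nat -> nat) (ha : is_ulam a) (n k i j : nat) :
  1 <= k -> k < n -> 1 <= i -> i < j -> j <= n ->
  a i + a j = a n + a k -> (i = k /\ j = n) \/ (k < i /\ j < n).
Proof.
  intros Hk Hkn Hi Hij Hj E.
  destruct (Nat.eq_dec j n) as [-> | Nj].
  - left. split; [|reflexivity].
    destruct (Nat.lt_trichotomy i k) as [L | [L | L]]; [|exact L|].
    + pose proof (ulam_lt a ha i k). lia.
    + pose proof (ulam_lt a ha k i). lia.
  - right. split; [|lia].
    destruct (le_lt_dec i k) as [L | L]; [|exact L].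
    pose proof (ulam_le a ha i k). pose proof (ulam_lt a ha j n). lia.
Qed.

Lemma ulam_next_le (a : nat -> nat) (ha : is_ulam a) (n k : nat) :
  2 <= n -> 1 <= k -> k < n ->
  (forall i j, k < i -> i < j -> j < n -> a i + a j <> a n + a k) ->
  a (n + 1) <= a n + a k.
Proof.
  intros Hn Hk Hkn H.
  assert (Hm : forall m, a n < m -> unique_sum a n m -> a (n + 1) <= m).
  { destruct ha as (_ & _ & A). apply A. exact Hn. }
  apply Hm.
  - pose proof (ulam_pos a ha k). lia.
  - exists (k, n). split; [lia|].
    intros [i j] (K1 & K2 & K3 & K4).
    destruct (ulam_sum_between a ha n k i j) as [[-> ->] | [L1 L2]];
      try assumption; [reflexivity|].
    exfalso. now apply (H i j).
Qed.

Lemma ulam_step (a : nat -> nat) (ha : is_ulam a) (n : nat) :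
  3 <= n -> a (n + 1) <= a n + a (n - 2).
Proof.
  intros Hn. apply ulam_next_le; [exact ha | lia..].
Qed.

Lemma ulam_recurrence (a : nat -> nat) (ha : is_ulam a) (n : nat) :
  6 <= n ->
  a (n + 1) <= a n + a (n - 3) \/
  a (n + 1) <= a (n - 1) + a (n - 2) + a (n - 5).
Proof.
  intros Hn.
  destruct (Nat.eq_dec (a (n - 2) + a (n - 1)) (a n + a (n - 3))) as [E | E].
  - right.
    pose proof (ulam_step a ha n).
    pose proof (ulam_step a ha (n - 3)) as H3.
    replace (n - 3 + 1) with (n - 2) in H3 by lia.
    replace (n - 3 - 2) with (n - 5) in H3 by lia.
    lia.
  - left. apply ulam_next_le; [exact ha | lia..|].
    intros i j Hi Hij Hj.
    replace i with (n - 2) by lia. replace j with (n - 1) by lia. exact E.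
Qed.

Lemma ulam_exp_bound (a : nat -> nat) (ha : is_ulam a) (n : nat) :
  1 <= n -> (INR (a n) <= INR (a 6%nat) * 1.41 ^ n)%R.
Proof.
  induction n as [n IH] using lt_wf_ind. intros Hn.
  pose proof (pos_INR (a 6%nat)) as HC.
  destruct (le_lt_dec n 6) as [L | L].
  - assert (H : (INR (a n) <= INR (a 6%nat))%R) by (apply le_INR, ulam_le; auto).
    assert (P : (1 <= 1.41 ^ n)%R) by (apply pow_R1_Rle; lra).
    nra.
  (* With [n = k + 7], every power involved is a multiple of [1.41 ^ k]. *)
  - destruct (Nat.le_exists_sub 7 n L) as [k [-> _]].
    pose proof (ulam_recurrence a ha (k + 6)) as R.
    replace (k + 6 + 1) with (k + 7) in R by lia.
    replace (k + 6 - 3) with (k + 3) in R by lia.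
    replace (k + 6 - 1) with (k + 5) in R by lia.
    replace (k + 6 - 2) with (k + 4) in R by lia.
    replace (k + 6 - 5) with (k + 1) in R by lia.
    pose proof (IH (k + 6)) as I6. pose proof (IH (k + 5)) as I5.
    pose proof (IH (k + 4)) as I4. pose proof (IH (k + 3)) as I3.
    pose proof (IH (k + 1)) as I1.
    specialize (I6 ltac:(lia) ltac:(lia)). specialize (I5 ltac:(lia) ltac:(lia)).
    specialize (I4 ltac:(lia) ltac:(lia)). specialize (I3 ltac:(lia) ltac:(lia)).
    specialize (I1 ltac:(lia) ltac:(lia)).
    assert (HQ : (0 <= INR (a 6%nat) * 1.41 ^ k)%R).
    { apply Rmult_le_pos; [exact HC|]. apply pow_le. lra. }
    rewrite pow_add, <- Rmult_assoc in *.
    set (Q := (INR (a 6%nat) * 1.41 ^ k)%R) in *.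
    destruct R as [R | R]; [lia| |]; apply le_INR in R;
      rewrite !plus_INR in R; simpl pow in *; lra.
Qed.

Lemma geometric_eventually_le (C x y : R) :
  (0 < x)%R -> (x < y)%R ->
  exists N : nat, forall n : nat, N <= n -> (C * x ^ n <= y ^ n)%R.
Proof.
  intros Hx Hxy.
  assert (Hq : (1 < y / x)%R).
  { apply Rmult_lt_reg_r with x; [exact Hx|].
    replace (y / x * x)%R with y by (field; lra). lra. }
  destruct (Pow_x_infinity (y / x) ltac:(rewrite Rabs_pos_eq; lra) C)
    as [N HN].
  exists N. intros n Hn. specialize (HN n Hn).
  rewrite Rabs_pos_eq in HN by (apply pow_le; lra).
  replace y with (y / x * x)%R at 1 by (field; lra).
  rewrite Rpow_mult_distr.
  apply Rmult_le_compat_r; [apply pow_le|]; lra.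
Qed.

Theorem theorem1 (a : nat -> nat) (ha : is_ulam a) :
  exists N : nat, forall n : nat, (N <= n)%nat ->
    (INR (a n) <= 1.454 ^ n)%R.
Proof.
  destruct (geometric_eventually_le (INR (a 6%nat)) 1.41 1.454) as [N HN];
    [lra | lra |].
  (* The bound is only available from index 1 on, as [a 0] is arbitrary. *)
  exists (S N). intros n Hn.
  apply Rle_trans with (INR (a 6%nat) * 1.41 ^ n)%R.
  - apply ulam_exp_bound; [exact ha | lia].
  - apply HN. lia.
Qed.
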